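(* Let $\pi_1:V_1\to X_1$ and $\pi_2:V_2\to X_2$ be two diffeological vector pseudo-bundles. Let $Y\subset X_1$, let $f:Y\to X_2$ be a smooth injective map ($Y$ carrying the subset diffeology), and let $\tilde f:\pi_1^{-1}(Y)\to V_2$ be a smooth map (for the subset diffeology on $\pi_1^{-1}(Y)$) that is linear on each fibre and satisfies $\pi_2\circ\tilde f=f\circ \pi_1|_{\pi_1^{-1}(Y)}$. Let $\pi:V_1\cup_{\tilde f}V_2\to X_1\cup_f X_2$ be the map induced by $\pi_1$ and $\pi_2$, where both glued spaces carry their gluing diffeologies. Then $\pi:V_1\cup_{\tilde f}V_2\to X_1\cup_f X_2$ is a diffeological vector pseudo-bundle.
   Context: A diffeology on a set $X$ is a collection of maps (plots) $U\to X$, with $U$ ranging over open subsets of $\mathbb{R}^n$ for all $n$, containing all constant maps, closed under precomposition with ordinary smooth maps between domains, and local (a map that is locally a plot is a plot). A map between diffeological spaces is smooth if it sends plots to plots by composition. The subset diffeology on $Y\subset X$ consists of the plots of $X$ with image in $Y$; the product diffeology on $X\times Y$ consists of the maps whose two components are plots; the sum diffeology on $X_1\sqcup X_2$ consists of maps that are locally plots of $X_1$ or of $X_2$; the quotient diffeology consists of maps that locally lift to plots of the total space. $\mathbb{R}$ has the standard diffeology (ordinary smooth maps). Diffeological vector pseudo-bundle: a smooth map $\pi:V\to X$ of diffeological spaces such that each fibre $\pi^{-1}(x)$ carries a (real) vector space structure and (1) the fibrewise addition $V\times_X V\to V$ is smooth ($V\times_XV\subset V\times V$ with the subset diffeology),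 (2) the scalar multiplication $\mathbb{R}\times V\to V$ is smooth, (3) the zero section $X\to V$ is smooth. Gluing: for diffeological spaces $X_1,X_2$, a subset $Y\subset X_1$ and a smooth map $f:Y\to X_2$, $X_1\cup_fX_2$ is the quotient of $X_1\sqcup X_2$ by the equivalence relation generated by $y\sim f(y)$, $y\in Y$. The gluing diffeology on it is the quotient diffeology of the sum diffeology on $X_1\sqcup X_2$. The space $V_1\cup_{\tilde f}V_2$ is defined in the same way from $\tilde f:\pi_1^{-1}(Y)\to V_2$. The induced map $\pi$ sends the class of $v\in V_i$ to the class of $\pi_i(v)$. The vector space structure on the fibre of $\pi$ over a point coming from $X_1\setminus Y$ is that of the corresponding fibre of $\pi_1$; over every other point, which is the class of a point $x_2\in X_2$, it is that of $\pi_2^{-1}(x_2)$. *)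

(* Defs.v *)
From HB Require Import structures.
From mathcomp Require Import all_boot all_order all_algebra.
From mathcomp Require Import all_classical all_reals all_analysis.
From mathcomp Require Import generic_quotient.
From Stdlib Require Import Relation_Operators.
Set Implicit Arguments.
Unset Strict Implicit.
Unset Printing Implicit Defensive.
Import Order.TTheory GRing.Theory Num.Theory.
Import numFieldNormedType.Exports.
Local Open Scope classical_set_scope.
Local Open Scope ring_scope.

Section Calculus.
Context {R : realType}.

(* Meaningful for open U only: being C^k on an open U depends only on the
   values of F on U (Ck_eq). *)
Fixpoint Ck {n : nat} {W : normedModType R} (k : nat) (U : set 'rV[R]_n)
    (F : 'rV[R]_n -> W) : Prop :=
  if k is k'.+1 then
    (forall x, U x -> differentiable F x) /\
    (forall v, Ck k' U (fun x => 'D_v F x))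
  else forall x, U x -> {for x, continuous F}.

Definition smooth_on {n : nat} {W : normedModType R} (U : set 'rV[R]_n)
    (F : 'rV[R]_n -> W) : Prop := forall k, Ck k U F.

Lemma differentiable_near0 (V W : normedModType R) (h : V -> W) (x : V) :
  (\near x, h x = 0) -> differentiable h x.
Proof.
move=> h0.
have hx : h x = 0 by exact: (nbhs_singleton h0).
have E : h \o shift x = cst (h x) + \0 +o_ 0 id.
  apply/eqaddoP => e e0.
  have : \forall y \near (0 : V), h (y + x) = 0.
    rewrite (near_shift x) /=; apply: filterS h0 => y hy; by rewrite sub0r /= subrK.
  apply: filterS => y yx /=.
  by rewrite !fctE /= yx hx addr0 subrr normr0 mulr_ge0 // ltW.
pose c0 : {linear V -> W} := \0.
have c0c : continuous (c0 : V -> W) by exact: cst_continuous.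
by apply/diff_locallyP; rewrite (@diff_unique _ _ _ h c0 x c0c E).
Unshelve. all: by end_near. Qed.

Lemma near_eq_differentiable (V W : normedModType R) (f g : V -> W) (x : V) :
  (\near x, f x = g x) -> differentiable f x -> differentiable g x.
Proof.
move=> fg df; rewrite (_ : g = f + (g - f)); last by rewrite addrC subrK.
apply: differentiableD => //; apply: differentiable_near0.
by apply: filterS fg => y fgy; rewrite !fctE fgy subrr.
Qed.

Section OnOpen.
Context {n : nat} (U : set 'rV[R]_n) (oU : open U).

Lemma near_open (P : 'rV[R]_n -> Prop) (x : 'rV[R]_n) :
  U x -> (forall y, U y -> P y) -> \near x, P x.
Proof. by move=> Ux UP; apply: filterS UP _; exact: open_nbhs_nbhs. Qed.

Lemma Ck_eq {W : normedModType R} k (F G : 'rV[R]_n -> W) :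
  (forall x, U x -> F x = G x) -> Ck k U F -> Ck k U G.
Proof.
elim: k F G => [|k IH] F G FG /=.
  move=> cF x Ux; have FGx := near_open Ux FG.
  rewrite /prop_for /continuous_at -(FG _ Ux).
  by apply: cvg_trans (cF _ Ux); apply: (@near_eq_cvg _ _ (nbhs x) _ F G).
move=> [dF DF]; split=> [x Ux|v].
  by apply: near_eq_differentiable (dF _ Ux); exact: near_open.
apply: IH (DF v) => x Ux.
by apply: near_eq_derive; exact: near_open.
Qed.

Lemma Ck_down {W : normedModType R} k (F : 'rV[R]_n -> W) :
  Ck k.+1 U F -> Ck k U F.
Proof.
elim: k F => [|k IH] F [dF DF].
  by move=> x Ux; apply: differentiable_continuous; exact: dF.
by split=> // v; apply: IH.
Qed.

Lemma CkD {W : normedModType R} k (F G : 'rV[R]_n -> W) :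
  Ck k U F -> Ck k U G -> Ck k U (fun x => F x + G x).
Proof.
elim: k F G => [|k IH] F G /=.
  by move=> cF cG x Ux; apply: continuousD; [exact: cF|exact: cG].
move=> [dF DF] [dG DG]; split=> [x Ux|v].
  by apply: differentiableD; [exact: dF|exact: dG].
apply: Ck_eq (IH _ _ (DF v) (DG v)) => x Ux.
by rewrite -deriveD //; apply: diff_derivable; [exact: dF|exact: dG].
Qed.

Lemma Ck_cst {W : normedModType R} k (c : W) : Ck k U (fun=> c).
Proof.
elim: k c => [|k IH] c /=; first by move=> x _; exact: cst_continuous.
split=> [x _|v]; first exact: differentiable_cst.
by apply: Ck_eq (IH 0) => x _; rewrite derive_cst.
Qed.

Lemma Ck_sum {W : normedModType R} k m (F : 'I_m -> 'rV[R]_n -> W) :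
  (forall i, Ck k U (F i)) -> Ck k U (fun x => \sum_i F i x).
Proof.
elim: m F => [|m IH] F CF.
  by apply: Ck_eq (Ck_cst k 0) => x _; rewrite big_ord0.
apply: Ck_eq (CkD (CF ord0) (IH (fun i => F (lift ord0 i)) _)) => // x _.
by rewrite big_ord_recl.
Qed.

End OnOpen.

Lemma scale_is_bilinear (W : normedModType R) :
  bilinear_for
    (GRing.Scale.Law.clone _ _ *:%R _) (GRing.Scale.Law.clone _ _ *:%R _)
    (fun (a : R) (w : W) => a *: w).
Proof.
split=> [u'|u] a x y /=; first by rewrite scalerDl scalerA.
by rewrite scalerDr !scalerA mulrC.
Qed.

Lemma is_diff_scale (W : normedModType R) (p : R * W) :
  is_diff p (fun q : R * W => q.1 *: q.2)
            (fun q => p.1 *: q.2 + q.1 *: p.2).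
Proof.
pose m := bilinear_isBilinear.Build R R W W _ _ _ (@scale_is_bilinear W).
pose b : {bilinear R -> W -> W} := HB.pack (fun (a : R) (w : W) => a *: w) m.
have cb : continuous (fun q : R * W => b q.1 q.2) by exact: scale_continuous.
apply: DiffDef; first exact: (differentiable_bilin p cb).
exact: (diff_bilin p cb).
Qed.

Section Scale.
Context {n : nat} (U : set 'rV[R]_n) (oU : open U).

Lemma CkZ {W : normedModType R} k (a : 'rV[R]_n -> R) (F : 'rV[R]_n -> W) :
  Ck k U a -> Ck k U F -> Ck k U (fun x => a x *: F x).
Proof.
elim: k a F => [|k IH] a F.
  by move=> ca cF x Ux; apply: continuousZ; [exact: ca|exact: cF].
move=> Ca CF; have [da Da] := Ca; have [dF DF] := CF.
have D x : U x -> is_diff x (fun x => a x *: F x)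
    (fun v => a x *: 'D_v F x + 'D_v a x *: F x).
  move=> Ux; have aP := differentiableP (da _ Ux).
  have FP := differentiableP (dF _ Ux).
  have := is_diff_comp (is_diff_pair aP FP) (is_diff_scale (a x, F x)).
  move=> /is_diff_eq; apply; apply/funext => v /=.
  by rewrite !deriveE //.
split=> [x Ux|v]; first by have [] := D _ Ux.
have CaF := IH _ _ (Ck_down Ca) (DF v).
have CFa := IH _ _ (Da v) (Ck_down CF).
apply: Ck_eq (CkD oU CaF CFa) => // x Ux.
by have [dd e] := D _ Ux; rewrite [RHS]deriveE // e.
Qed.

End Scale.

Lemma Ck_coord n m (U : set 'rV[R]_n) k (F : 'rV[R]_n -> 'rV[R]_m) i :
  open U -> Ck k U F -> Ck k U (fun x => F x 0 i).
Proof.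
move=> oU; elim: k F => [|k IH] F /=.
  move=> cF x Ux; apply: (@continuous_comp _ _ _ F (fun y : 'rV[R]_m => y 0 i)).
    exact: cF.
  exact: coord_continuous.
move=> [dF DF]; split=> [x Ux|v].
  apply: (@differentiable_comp _ _ _ _ F (fun y : 'rV[R]_m => y 0 i)).
    exact: dF.
  exact: differentiable_coord.
apply: (Ck_eq oU _ (IH _ (DF v))) => x Ux.
have dFx := @diff_derivable _ _ _ _ _ v (dF _ Ux).
by rewrite derive_mx // mxE.
Qed.

Lemma Ck_comp n m (W : normedModType R) (U : set 'rV[R]_n) (V : set 'rV[R]_m)
    k (f : 'rV[R]_n -> 'rV[R]_m) (g : 'rV[R]_m -> W) :
  open U -> (forall x, U x -> V (f x)) ->
  Ck k U f -> Ck k V g -> Ck k U (g \o f).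
Proof.
move=> oU UV; elim: k f g UV => [|k IH] f g UV.
  move=> cf cg x Ux; apply: continuous_comp; first exact: cf.
  by apply: cg; exact: UV.
move=> Cf Cg; have [df Df] := Cf; have [dg Dg] := Cg; split=> [x Ux|v].
  exact: differentiable_comp (df _ Ux) (dg _ (UV _ Ux)).
have H i : Ck k U (fun x => 'D_v f x 0 i *: ('D_(delta_mx 0 i) g \o f) x).
  apply: CkZ => //; first exact: (Ck_coord i oU (Df v)).
  exact: (IH _ _ UV (Ck_down Cf) (Dg _)).
apply: Ck_eq (Ck_sum oU H) => // x Ux.
have dfx := df _ Ux; have dgx := dg _ (UV _ Ux).
rewrite [RHS]deriveE; last exact: differentiable_comp.
rewrite diff_comp //= -(deriveE v dfx) [in RHS](row_sum_delta ('D_v f x)).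
rewrite linear_sum; apply: eq_bigr => i _.
by rewrite linearZ /= -deriveE.
Qed.

Lemma Ck_id n (U : set 'rV[R]_n) k : open U -> Ck k U id.
Proof.
move=> oU; case: k => [|k]; first by move=> x _; exact: cvg_id.
split=> [x _|v]; first by have [] := is_diff_id x.
by apply: Ck_eq (Ck_cst oU k v) => // x _; rewrite derive_id.
Qed.

Lemma Ck_sub n (W : normedModType R) (U V : set 'rV[R]_n) k
    (F : 'rV[R]_n -> W) : U `<=` V -> Ck k V F -> Ck k U F.
Proof.
move=> UV; elim: k F => [|k IH] F; first by move=> cF x /UV; exact: cF.
by move=> [dF DF]; split=> [x /UV|v]; [exact: dF|exact: (IH _ (DF v))].
Qed.

Lemma Ck_local n (W : normedModType R) (U : set 'rV[R]_n) k
    (F : 'rV[R]_n -> W) :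
  (forall x, U x -> exists V : set 'rV[R]_n, V x /\ Ck k V F) -> Ck k U F.
Proof.
elim: k F => [|k IH] F CF.
  by move=> x /CF [V [Vx cF]]; exact: cF.
split=> [x /CF [V [Vx [dF _]]]|v]; first exact: dF.
by apply: IH => x /CF [V [Vx [_ DF]]]; exists V; split=> //; exact: DF.
Qed.

End Calculus.

Section Sets.
Context {T : Type}.

Definition into (A : set T) (x : T) (Ax : A x) : A := exist _ x (mem_set Ax).

Lemma ofset (A : set T) (a : A) : A (val a).
Proof. exact: set_mem (valP a). Qed.

Definition set_incl (A B : set T) (AB : A `<=` B) (a : A) : B :=
  into (AB _ (ofset a)).

Lemma val_incl (A B : set T) (AB : A `<=` B) (a : A) :
  val (set_incl AB a) = val a.
Proof. by []. Qed.

End Sets.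

Section Diffeology.
Context {R : realType}.

Record domain (n : nat) := Domain {
  dset :> set 'rV[R]_n;
  dopen : open dset }.

Arguments dopen {n} d.

Definition domain_smooth m n (V : domain m) (U : domain n) (g : V -> U) :=
  exists2 G : 'rV[R]_m -> 'rV[R]_n,
    smooth_on (dset V) G & forall v : V, val (g v) = G (val v).

Lemma domain_smooth_comp l m n (W : domain l) (V : domain m) (U : domain n)
    (g : V -> U) (h : W -> V) :
  domain_smooth g -> domain_smooth h -> domain_smooth (g \o h).
Proof.
move=> [G sG gG] [H sH hH]; exists (G \o H) => [k|w /=]; last by rewrite gG hH.
apply: (Ck_comp (dopen W) _ (sH k) (sG k)) => x Wx.
by rewrite -(hH (into Wx)); exact: ofset.
Qed.

Lemma domain_smooth_incl n (W U : domain n) (s : W `<=` U) :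
  domain_smooth (set_incl s).
Proof. by exists id => [k|//]; exact: Ck_id (dopen W). Qed.

Lemma preimage_open m n (V : domain m) (U W : domain n) (g : V -> U) :
  domain_smooth g -> open [set x | exists v : V, x = val v /\ dset W (val (g v))].
Proof.
move=> [G sG gG]; rewrite openE => _ [v [-> Wgv]].
have cG : {for val v, continuous G} := sG 0 _ (ofset v).
have nW : nbhs (G (val v)) W by apply: open_nbhs_nbhs; rewrite -gG; split=> //; exact: dopen.
have nV : nbhs (val v) V.
  by apply: open_nbhs_nbhs; split; [exact: dopen|exact: ofset].
rewrite /interior /=; apply: filterS2 nV (cG _ nW) => y Vy Wy.
by exists (into Vy); split => //; rewrite gG.
Qed.

Definition preimage_dom m n (V : domain m) (U W : domain n) (g : V -> U)
  (sg : domain_smooth g) : domain m := Domain (@preimage_open _ _ V U W g sg).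

Lemma preimage_dom_sub m n (V : domain m) (U W : domain n) (g : V -> U)
  (sg : domain_smooth g) : preimage_dom W sg `<=` V.
Proof. by move=> _ [v [-> _]]; exact: ofset. Qed.

Definition preimage_map m n (V : domain m) (U W : domain n) (g : V -> U)
  (sg : domain_smooth g) (x : preimage_dom W sg) : W.
Proof.
apply: (@into _ W (val (g (set_incl (@preimage_dom_sub _ _ _ _ _ _ sg) x)))).
have [v [xv Wv]] := ofset x.
by rewrite (_ : set_incl _ x = v) //; apply: val_inj.
Defined.

Lemma preimage_map_smooth m n (V : domain m) (U W : domain n) (g : V -> U)
  (sg : domain_smooth g) : domain_smooth (@preimage_map _ _ _ _ W _ sg).
Proof.
have [G sG gG] := sg; exists G => [k|x]; last by rewrite /= gG.
by apply: Ck_sub (sG k); exact: preimage_dom_sub.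
Qed.

Record diffspace := DiffSpace {
  carrier :> Type;
  plot : forall n (U : domain n), (U -> carrier) -> Prop;
  plot_cst : forall n (U : domain n) (x : carrier), plot (fun _ : U => x);
  plot_comp : forall m n (V : domain m) (U : domain n) (g : V -> U)
    (p : U -> carrier), domain_smooth g -> plot p -> plot (p \o g);
  plot_local : forall n (U : domain n) (p : U -> carrier),
    (forall u : U, exists (W : domain n) (s : W `<=` U),
      dset W (val u) /\ plot (p \o set_incl s)) -> plot p }.

Definition dsmooth (X Z : diffspace) (h : X -> Z) : Prop :=
  forall n (U : domain n) (p : U -> X), plot p -> plot (h \o p).

Section Localize.
Context (X : Type) (P : forall n (U : domain n), (U -> X) -> Prop).

Definition locally_plot n (U : domain n) (p : U -> X) : Prop :=
  forall u : U, exists (W : domain n) (s : W `<=` U),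
    dset W (val u) /\ P (p \o set_incl s).

Hypothesis P_comp : forall m n (V : domain m) (U : domain n) (g : V -> U)
  (p : U -> X), domain_smooth g -> P p -> P (p \o g).

Lemma locally_plotW n (U : domain n) (p : U -> X) : P p -> locally_plot p.
Proof.
move=> Pp u; exists U, (@subset_refl _ U); split; first exact: ofset.
by apply: P_comp => //; exact: domain_smooth_incl.
Qed.

Lemma locally_plot_comp m n (V : domain m) (U : domain n) (g : V -> U)
  (p : U -> X) : domain_smooth g -> locally_plot p -> locally_plot (p \o g).
Proof.
move=> sg lp v; have [W [s [Wgv Pp]]] := lp (g v).
exists (preimage_dom W sg), (@preimage_dom_sub _ _ _ _ _ _ sg).
split; first by exists v.
rewrite (_ : _ \o _ = (p \o set_incl s) \o @preimage_map _ _ _ _ W _ sg).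
  by apply: P_comp => //; exact: preimage_map_smooth.
by apply/funext => x /=; congr p; exact: val_inj.
Qed.

Lemma locally_plot_local n (U : domain n) (p : U -> X) :
  (forall u : U, exists (W : domain n) (s : W `<=` U),
    dset W (val u) /\ locally_plot (p \o set_incl s)) -> locally_plot p.
Proof.
move=> H u; have [W [s [Wu lp]]] := H u.
have [W' [s' [W'u Pp]]] := lp (into Wu).
exists W', (subset_trans s' s); split=> //.
rewrite (_ : _ \o _ = (p \o set_incl s) \o set_incl s') //.
by apply/funext => x /=; congr p; exact: val_inj.
Qed.

End Localize.

Section RealLine.

Definition real_plot n (U : domain n) (p : U -> R) : Prop :=
  exists2 F : 'rV[R]_n -> R, smooth_on (dset U) F &
    forall u : U, p u = F (val u).

Lemma real_plot_cst n (U : domain n) (x : R) : real_plot (fun _ : U => x).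
Proof. by exists (fun=> x) => // k; exact (Ck_cst (dopen U) k x). Qed.

Lemma real_plot_comp m n (V : domain m) (U : domain n) (g : V -> U)
  (p : U -> R) : domain_smooth g -> real_plot p -> real_plot (p \o g).
Proof.
move=> [G sG gG] [F sF pF]; exists (F \o G) => [k|v /=]; last by rewrite pF gG.
apply: (Ck_comp (dopen V) _ (sG k) (sF k)) => x Vx.
by rewrite -(gG (into Vx)); exact: ofset.
Qed.

Lemma real_plot_local n (U : domain n) (p : U -> R) :
  (forall u : U, exists (W : domain n) (s : W `<=` U),
    dset W (val u) /\ real_plot (p \o set_incl s)) -> real_plot p.
Proof.
move=> H.
pose F x := if pselect (dset U x) is left Ux then p (into Ux) else 0.
have FE (u : U) : p u = F (val u).
  rewrite /F; case: pselect => [Ux|]; last by case; exact: ofset.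
  by congr p; exact: val_inj.
exists F => // k; apply: Ck_local => x Ux.
have [W [s [Wx [G sG pG]]]] := H (into Ux).
exists W; split=> //; apply: Ck_eq (sG k); first exact: dopen.
by move=> y Wy; rewrite -(pG (into Wy)) /= FE.
Qed.

Definition real_space : diffspace :=
  DiffSpace real_plot_cst real_plot_comp real_plot_local.

End RealLine.

Section Subset.
Context (X : diffspace) (Y : set X).

Definition subset_plot n (U : domain n) (p : U -> Y) : Prop :=
  plot (fun u => val (p u)).

Lemma subset_plot_cst n (U : domain n) (x : Y) : subset_plot (fun _ : U => x).
Proof. exact: plot_cst. Qed.

Lemma subset_plot_comp m n (V : domain m) (U : domain n) (g : V -> U)
  (p : U -> Y) : domain_smooth g -> subset_plot p -> subset_plot (p \o g).
Proof. by move=> sg; exact: plot_comp. Qed.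

Lemma subset_plot_local n (U : domain n) (p : U -> Y) :
  (forall u : U, exists (W : domain n) (s : W `<=` U),
    dset W (val u) /\ subset_plot (p \o set_incl s)) -> subset_plot p.
Proof. by move=> H; apply: plot_local => u; exact: H. Qed.

Definition subset_space : diffspace :=
  DiffSpace subset_plot_cst subset_plot_comp subset_plot_local.

End Subset.

Section Product.
Context (X Z : diffspace).

Definition prod_plot n (U : domain n) (p : U -> X * Z) : Prop :=
  plot (fun u => (p u).1) /\ plot (fun u => (p u).2).

Lemma prod_plot_cst n (U : domain n) (x : X * Z) : prod_plot (fun _ : U => x).
Proof. by split; exact: plot_cst. Qed.

Lemma prod_plot_comp m n (V : domain m) (U : domain n) (g : V -> U)
  (p : U -> X * Z) : domain_smooth g -> prod_plot p -> prod_plot (p \o g).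
Proof.
move=> sg [p1 p2]; split.
  exact: (plot_comp sg p1).
exact: (plot_comp sg p2).
Qed.

Lemma prod_plot_local n (U : domain n) (p : U -> X * Z) :
  (forall u : U, exists (W : domain n) (s : W `<=` U),
    dset W (val u) /\ prod_plot (p \o set_incl s)) -> prod_plot p.
Proof.
move=> H; split; apply: plot_local => u; have [W [s [Wu [p1 p2]]]] := H u.
  by exists W, s.
by exists W, s.
Qed.

Definition prod_space : diffspace :=
  DiffSpace prod_plot_cst prod_plot_comp prod_plot_local.

End Product.

Section Sum.
Context (X1 X2 : diffspace).

Definition summand_plot n (U : domain n) (p : U -> X1 + X2) : Prop :=
  (exists2 q : U -> X1, plot q & forall u, p u = inl (q u)) \/
  (exists2 q : U -> X2, plot q & forall u, p u = inr (q u)).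

Lemma summand_plot_cst n (U : domain n) (x : X1 + X2) :
  summand_plot (fun _ : U => x).
Proof.
case: x => x; [left|right]; exists (fun=> x) => //; exact: plot_cst.
Qed.

Lemma summand_plot_comp m n (V : domain m) (U : domain n) (g : V -> U)
  (p : U -> X1 + X2) : domain_smooth g -> summand_plot p -> summand_plot (p \o g).
Proof.
move=> sg [[q qp pq]|[q qp pq]]; [left|right]; exists (q \o g);
  by [exact: plot_comp|move=> v /=; rewrite pq].
Qed.

Definition sum_space : diffspace := DiffSpace
  (fun n U x => locally_plotW summand_plot_comp (@summand_plot_cst n U x))
  (locally_plot_comp summand_plot_comp)
  (@locally_plot_local _ summand_plot).

End Sum.

Section Quotient.
Context (X : diffspace) (r : X -> X -> Prop).

Definition generated_rel (x y : {classic X}) : bool :=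
  `[< clos_refl_sym_trans X r x y >].

Lemma generated_rel_refl : reflexive generated_rel.
Proof. by move=> x; apply/asboolP; exact: rst_refl. Qed.

Lemma generated_rel_sym : symmetric generated_rel.
Proof. by move=> x y; apply/asboolP/asboolP; exact: rst_sym. Qed.

Lemma generated_rel_trans : transitive generated_rel.
Proof.
move=> y x z /asboolP xy /asboolP yz; apply/asboolP.
exact: (rst_trans _ _ x y z).
Qed.

Definition generated_equiv : equiv_rel {classic X} :=
  EquivRel generated_rel generated_rel_refl generated_rel_sym
    generated_rel_trans.

Definition quot : Type := {eq_quot generated_equiv}%qT.

Definition cls (x : X) : quot := (\pi_({eq_quot generated_equiv}) x)%qT.

Definition rep (c : quot) : X := repr (c : {eq_quot generated_equiv}%qT).

Lemma repK : cancel rep cls.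
Proof. by move=> c; exact: reprK. Qed.

Lemma cls_eqP (x y : X) : cls x = cls y <-> clos_refl_sym_trans X r x y.
Proof.
split; first by move/eqmodP/asboolP.
by move=> xy; apply/eqmodP/asboolP.
Qed.

Definition lifted_plot n (U : domain n) (p : U -> quot) : Prop :=
  exists2 q : U -> X, plot q & forall u, p u = cls (q u).

Lemma lifted_plot_cst n (U : domain n) (c : quot) : lifted_plot (fun _ : U => c).
Proof. by exists (fun=> rep c) => [|u]; [exact: plot_cst|rewrite repK]. Qed.

Lemma lifted_plot_comp m n (V : domain m) (U : domain n) (g : V -> U)
  (p : U -> quot) : domain_smooth g -> lifted_plot p -> lifted_plot (p \o g).
Proof.
move=> sg [q qp pq]; exists (q \o g); first exact: plot_comp.
by move=> v /=; rewrite pq.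
Qed.

Definition quot_space : diffspace := DiffSpace
  (fun n U x => locally_plotW lifted_plot_comp (@lifted_plot_cst n U x))
  (locally_plot_comp lifted_plot_comp)
  (@locally_plot_local _ lifted_plot).

End Quotient.

End Diffeology.

Arguments domain R n : clear implicits.
Arguments diffspace R : clear implicits.
Arguments real_space R : clear implicits.

Section Pseudobundle.
Context {R : realType} {V X : diffspace R}.

Definition fibre (pi : V -> X) (x : X) : set V := pi @^-1` [set x].

(* The equality and choice structures that an Lmodule class also carries play no
   role. *)
Definition fibre_structure (pi : V -> X) : Type :=
  forall x, GRing.Lmodule R (fibre pi x).

Context (pi : V -> X) (vs : fibre_structure pi).

Definition fibre_mod (x : X) : lmodType R := GRing.Lmodule.Pack (vs x).

Definition in_fibre (x : X) (v : V) (e : pi v = x) : fibre_mod x :=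
  @into _ (fibre pi x) v e.

Definition fibre_prod : set (V * V) := [set uv | pi uv.1 = pi uv.2].

Definition fibre_add (uv : subset_space (X := prod_space V V) fibre_prod) : V :=
  let u := (val uv).1 in let v := (val uv).2 in
  val (in_fibre (erefl (pi u)) + in_fibre (esym (ofset uv : pi u = pi v))).

Definition fibre_scale (av : prod_space (real_space R) V) : V :=
  val ((av.1 : R) *: in_fibre (erefl (pi av.2))).

Definition zero_section (x : X) : V := val (0 : fibre_mod x).

Record is_pseudobundle : Prop := {
  proj_smooth : dsmooth pi;
  add_smooth : dsmooth fibre_add;
  scale_smooth : dsmooth fibre_scale;
  zero_smooth : dsmooth zero_section }.

End Pseudobundle.

Arguments is_pseudobundle {R V X} pi vs.

Section Transport.
Context {R : realType} (L : lmodType R) (T : Type) (h : L -> T).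
Hypothesis bij_h : bijective h.

Let inv_spec : exists g : T -> L, cancel h g /\ cancel g h.
Proof. by case: bij_h => g hg gh; exists g. Qed.

Definition transport_inv : T -> L := projT1 (cid inv_spec).

Lemma transportK : cancel h transport_inv.
Proof. exact: (projT2 (cid inv_spec)).1. Qed.

Lemma transport_invK : cancel transport_inv h.
Proof. exact: (projT2 (cid inv_spec)).2. Qed.

Definition transport : Type := T.

HB.instance Definition _ := gen_eqMixin transport.
HB.instance Definition _ := gen_choiceMixin transport.

Local Notation g := transport_inv.

Definition transport_add (x y : transport) : transport := h (g x + g y).
Definition transport_opp (x : transport) : transport := h (- g x).
Definition transport_zero : transport := h 0.
Definition transport_scale (a : R) (x : transport) : transport := h (a *: g x).

Lemma transport_addA : associative transport_add.
Proof. by move=> x y z; rewrite /transport_add !transportK addrA. Qed.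
Lemma transport_addC : commutative transport_add.
Proof. by move=> x y; rewrite /transport_add addrC. Qed.
Lemma transport_add0 : left_id transport_zero transport_add.
Proof. by move=> x; rewrite /transport_add transportK add0r transport_invK. Qed.
Lemma transport_addN : left_inverse transport_zero transport_opp transport_add.
Proof. by move=> x; rewrite /transport_add transportK addNr. Qed.

HB.instance Definition _ := GRing.isZmodule.Build transport
  transport_addA transport_addC transport_add0 transport_addN.

Lemma transport_scaleA a b (x : transport) :
  transport_scale a (transport_scale b x) = transport_scale (a * b) x.
Proof. by rewrite /transport_scale transportK scalerA. Qed.
Lemma transport_scale1 : left_id 1 transport_scale.
Proof. by move=> x; rewrite /transport_scale scale1r transport_invK. Qed.
Lemma transport_scaleDr : right_distributive transport_scale +%R.
Proof.
move=> a x y; rewrite /transport_scale -[x + y]/(transport_add x y).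
by rewrite -[RHS]/(transport_add _ _) /transport_add !transportK scalerDr.
Qed.
Lemma transport_scaleDl (x : transport) :
  {morph transport_scale^~ x : a b / a + b}.
Proof.
move=> a b; rewrite /transport_scale -[RHS]/(transport_add _ _).
by rewrite /transport_add !transportK scalerDl.
Qed.

HB.instance Definition _ := GRing.Zmodule_isLmodule.Build R transport
  transport_scaleA transport_scale1 transport_scaleDr transport_scaleDl.

(* The vector space structure on T making the bijection h linear
   (transport_linear). *)
Definition transport_lmod : GRing.Lmodule R T :=
  GRing.Lmodule.class (transport : lmodType R).

Lemma transport_linear :
  linear (h : L -> (GRing.Lmodule.Pack transport_lmod : lmodType R)).
Proof.
move=> a u v; rewrite -[RHS]/(transport_add (transport_scale a (h u)) (h v)).
by rewrite /transport_add /transport_scale !transportK.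
Qed.

End Transport.

Section Gluing.
Context {R : realType} (X1 X2 : diffspace R) (Y : set X1).
Context (f : subset_space Y -> X2).

Definition glue_rel (a b : sum_space X1 X2) : Prop :=
  exists y : Y, a = inl (val y) /\ b = inr (f y).

Definition glue_space : diffspace R := quot_space glue_rel.

Definition glue_cls (a : sum_space X1 X2) : glue_space := cls glue_rel a.

(* Normal forms of points of the disjoint union: y in Y is replaced by f y.
   Every class contains exactly one normal form, lying in X1 \ Y or in X2. *)
Definition glue_nf (a : sum_space X1 X2) : sum_space X1 X2 :=
  match a with
  | inl x => if pselect (Y x) is left Yx then inr (f (into Yx)) else inl x
  | inr x => inr x
  end.

Lemma glue_nf_in (y : Y) : glue_nf (inl (val y)) = inr (f y).
Proof.
rewrite /glue_nf; case: pselect => [Yy|]; last by case; exact: ofset.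
by congr (inr (f _)); exact: val_inj.
Qed.

Lemma glue_nf_out (x : X1) : ~ Y x -> glue_nf (inl x) = inl x.
Proof. by move=> Yx; rewrite /glue_nf; case: pselect. Qed.

Lemma glue_nfK (a : sum_space X1 X2) : glue_nf (glue_nf a) = glue_nf a.
Proof.
case: a => x //; have [Yx|Yx] := pselect (Y x); last by rewrite !glue_nf_out.
by rewrite (glue_nf_in (into Yx)).
Qed.

Lemma cls_glue_nf (a : sum_space X1 X2) : glue_cls (glue_nf a) = glue_cls a.
Proof.
case: a => x //; have [Yx|Yx] := pselect (Y x); last by rewrite !glue_nf_out.
rewrite (glue_nf_in (into Yx)); apply/cls_eqP; apply: rst_sym; apply: rst_step.
by exists (into Yx).
Qed.

Lemma glue_clsP (a b : sum_space X1 X2) :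
  glue_cls a = glue_cls b <-> glue_nf a = glue_nf b.
Proof.
split=> [/cls_eqP|ab]; last by rewrite -cls_glue_nf ab cls_glue_nf.
elim=> {a b} [a b [y [-> ->]]|//|a b _ //|a b c _ -> _ //].
by rewrite glue_nf_in.
Qed.

Definition glue_rep (c : glue_space) : sum_space X1 X2 := glue_nf (rep c).

Lemma glue_repK : cancel glue_rep glue_cls.
Proof. by move=> c; rewrite /glue_rep cls_glue_nf /glue_cls repK. Qed.

Lemma glue_rep_nf (c : glue_space) : glue_nf (glue_rep c) = glue_rep c.
Proof. exact: glue_nfK. Qed.

Lemma glue_clsK (a : sum_space X1 X2) : glue_rep (glue_cls a) = glue_nf a.
Proof. by apply/glue_clsP; rewrite /glue_cls repK. Qed.

End Gluing.

Section BundleGluing.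
Context {R : realType} {V1 X1 V2 X2 : diffspace R}.
Context (pi1 : V1 -> X1) (pi2 : V2 -> X2).
Context (vs1 : fibre_structure pi1) (vs2 : fibre_structure pi2).
Context (Y : set X1) (f : subset_space Y -> X2).
Context (ft : subset_space (pi1 @^-1` Y) -> V2).

Definition over_base (v : subset_space (pi1 @^-1` Y)) : subset_space Y :=
  into (ofset v : Y (pi1 (val v))).

Definition sum_proj (a : sum_space V1 V2) : sum_space X1 X2 :=
  match a with inl v => inl (pi1 v) | inr v => inr (pi2 v) end.

(* Independent of the chosen representative when pi2 o ft = f o pi1, see
   glue_projE. *)
Definition glue_proj (c : glue_space ft) : glue_space f :=
  glue_cls f (sum_proj (rep c)).

Hypothesis compat : forall v, pi2 (ft v) = f (over_base v).

Lemma sum_proj_nf (a : sum_space V1 V2) :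
  sum_proj (glue_nf ft a) = glue_nf f (sum_proj a).
Proof.
case: a => v //; have [Yv|Yv] := pselect (Y (pi1 v)); last first.
  by rewrite glue_nf_out // [RHS]glue_nf_out.
pose w : subset_space (pi1 @^-1` Y) := into (Yv : (pi1 @^-1` Y) v).
rewrite -[inl v]/(inl (val w)) glue_nf_in [LHS]/= compat.
by rewrite -[sum_proj _]/(inl (val (over_base w))) glue_nf_in.
Qed.

Lemma glue_projE (a : sum_space V1 V2) :
  glue_proj (glue_cls ft a) = glue_cls f (sum_proj a).
Proof.
apply/glue_clsP; rewrite -!sum_proj_nf; congr sum_proj.
by apply/glue_clsP; rewrite /glue_cls repK.
Qed.

Section FibreMap.
Context (y : subset_space Y).

Lemma over_fibre (v : fibre pi1 (val y)) : (pi1 @^-1` Y) (val v).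
Proof. by rewrite /= (ofset v : pi1 (val v) = val y); exact: ofset. Qed.

Lemma ft_fibre_subproof (v : fibre pi1 (val y)) :
  pi2 (ft (into (over_fibre v))) = f y.
Proof.
by rewrite compat; congr f; apply: val_inj; exact: (ofset v : pi1 _ = _).
Qed.

Definition ft_fibre (v : fibre_mod vs1 (val y)) : fibre_mod vs2 (f y) :=
  in_fibre vs2 (ft_fibre_subproof v).

End FibreMap.

(* The fibre of pi1 or pi2 over a point of the disjoint union. *)
Definition sum_fibre (a : sum_space X1 X2) : lmodType R :=
  match a with inl x => fibre_mod vs1 x | inr x => fibre_mod vs2 x end.

Definition sum_fibre_pt (a : sum_space X1 X2) :
    sum_fibre a -> sum_space V1 V2 :=
  match a with
  | inl x => fun v : fibre pi1 x => inl (val v)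
  | inr x => fun v : fibre pi2 x => inr (val v)
  end.

Lemma sum_proj_fibre_pt (a : sum_space X1 X2) (v : sum_fibre a) :
  sum_proj (sum_fibre_pt v) = a.
Proof.
by case: a v => [x|x] v /=; [congr inl|congr inr]; exact: (ofset v).
Qed.

Lemma glue_fibre_map_subproof (a : sum_space X1 X2) (c : glue_space f)
  (ac : glue_cls f a = c) (v : sum_fibre a) :
  glue_proj (glue_cls ft (sum_fibre_pt v)) = c.
Proof. by rewrite glue_projE sum_proj_fibre_pt. Qed.

(* The natural map from the fibre over a to the fibre of glue_proj over the
   class c of a. *)
Definition glue_fibre_map (a : sum_space X1 X2) (c : glue_space f)
    (ac : glue_cls f a = c) (v : sum_fibre a) : fibre glue_proj c :=
  into (glue_fibre_map_subproof ac v).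

Lemma sum_fibre_nf (a : sum_space X1 X2) (v : sum_fibre a) :
  glue_nf f a = a -> glue_nf ft (sum_fibre_pt v) = sum_fibre_pt v.
Proof.
case: a v => [x|x] v //= nfx; case: pselect => // Yv; exfalso; move: nfx.
have xv : pi1 (val v) = x := ofset v.
by case: pselect => // -[]; rewrite -xv.
Qed.

Lemma sum_fibre_pt_inj (a : sum_space X1 X2) : injective (@sum_fibre_pt a).
Proof. by case: a => x v w [] /val_inj. Qed.

Lemma sum_fibre_pt_surj (b : sum_space V1 V2) :
  exists v : sum_fibre (sum_proj b), sum_fibre_pt v = b.
Proof.
case: b => v.
  by exists (@into _ (fibre pi1 (pi1 v)) v erefl).
by exists (@into _ (fibre pi2 (pi2 v)) v erefl).
Qed.

Lemma glue_fibre_map_bij (a : sum_space X1 X2) (c : glue_space f)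
  (ac : glue_cls f a = c) : glue_nf f a = a -> bijective (glue_fibre_map ac).
Proof.
move=> nfa; have inj : injective (glue_fibre_map ac).
  move=> v w /(congr1 val) /= /glue_clsP.
  by rewrite !sum_fibre_nf // => /sum_fibre_pt_inj.
have surj (w : fibre glue_proj c) : exists v, glue_fibre_map ac v = w.
  pose b := glue_rep (val w).
  have eb : sum_proj b = a.
    have nfb : glue_nf f (sum_proj b) = sum_proj b.
      by rewrite -sum_proj_nf glue_rep_nf.
    rewrite -nfb -nfa; apply/glue_clsP.
    by rewrite -glue_projE glue_repK ac; exact: (ofset w).
  have [v vb] := sum_fibre_pt_surj b; move: v vb; rewrite eb => v vb.
  exists v; apply: val_inj => /=; rewrite vb; exact: glue_repK.
pose g w := projT1 (cid (surj w)).
have gK : cancel g (glue_fibre_map ac) by move=> w; exact: projT2 (cid (surj w)).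
by exists g => // v; apply: inj; rewrite gK.
Qed.

(* The vector space structure on the fibres of glue_proj: it is carried over
   from the fibre of pi1 when the normal form of c is in X1 \ Y, and from the
   fibre of pi2 otherwise. *)
Definition glue_fibre_structure : fibre_structure glue_proj := fun c =>
  transport_lmod (glue_fibre_map_bij (glue_repK c) (glue_rep_nf c)).

Lemma glue_fibre_map_linear (a : sum_space X1 X2) (c : glue_space f)
    (ac : glue_cls f a = c) : glue_nf f a = a ->
  linear (glue_fibre_map ac : sum_fibre a -> fibre_mod glue_fibre_structure c).
Proof.
move=> nfa; have ra : glue_rep c = a by rewrite -ac glue_clsK.
move: ac nfa; rewrite -ra => ac nfa.
rewrite (Prop_irrelevance ac (glue_repK c)); exact: transport_linear.
Qed.

Lemma glue_fibre_map_inl_linear (x : X1) : ~ Y x ->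
  linear (glue_fibre_map (erefl (glue_cls f (inl x))) :
    fibre_mod vs1 x -> fibre_mod glue_fibre_structure (glue_cls f (inl x))).
Proof.
move=> Yx.
exact: (@glue_fibre_map_linear (inl x) _ erefl (glue_nf_out f Yx)).
Qed.

Lemma glue_fibre_map_inr_linear (x : X2) :
  linear (glue_fibre_map (erefl (glue_cls f (inr x))) :
    fibre_mod vs2 x -> fibre_mod glue_fibre_structure (glue_cls f (inr x))).
Proof. exact: (@glue_fibre_map_linear (inr x) _ erefl erefl). Qed.

End BundleGluing.

Arguments over_base {R V1 X1} pi1 {Y} v.
Arguments ft_fibre {R V1 X1 V2 X2 pi1 pi2} vs1 vs2 {Y f ft} compat y v.
Arguments glue_proj {R V1 X1 V2 X2} pi1 pi2 {Y} f ft c.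
Arguments glue_fibre_structure {R V1 X1 V2 X2 pi1 pi2} vs1 vs2 {Y f ft} compat x.

(* Main.v *)
Require Import Defs.
From mathcomp Require Import all_boot all_order all_algebra.
From mathcomp Require Import all_classical all_reals all_analysis.
Set Implicit Arguments.
Unset Strict Implicit.
Unset Printing Implicit Defensive.
Import GRing.Theory.
Local Open Scope classical_set_scope.
Local Open Scope ring_scope.

(** Why the glued map is a pseudo-bundle.

    A plot of a glued space lifts, near each point of its domain, to a plot of
    one of the two pieces ([glue_plot_ind]), and the two pieces map smoothly to
    the glued space. So each of the four maps to be proved smooth (projection,
    addition, scalar multiplication, zero section) need only be computed on
    such lifts, where it should become the operation of [pi1] or [pi2] followed
    by the passage to classes.

    For the fibrewise operations this requires that the passage to classes be
    linear on every fibre of [pi1] and of [pi2]. Over a normal form it is linear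
    because the vector space structure is transported along it. The remaining
    case is the fibre of [pi1] over a point [y] of [Y]: there the passage to
    classes factors as [ft], linear by hypothesis, followed by the passage to
    classes on the fibre of [pi2] over [f y] ([glue_fibre_map_linear_any]).

    Addition involves two plots with the same projection, whose local lifts may
    lie in different pieces.
    - Both in [V1]: since [f] is injective, [X1] embeds in the glued base
      ([glue_inl_inj]), hence the lifts have the same projection in [X1] and can
      be added there. Without injectivity their projections could be
      two distinct points of [Y] identified by [f].
    - Both in [V2]: [X2] always embeds in the glued base.
    - One in each: the projection of the lift to [V1] is identified with a point
      of [X2], so that lift stays over [Y], and composing it with [ft] gives a
      lift of the same plot to [V2] ([glue_lift_over_Y]); this is the previous
      case. *)

(** * Plots of a glued space *)

Section GluedPlots.
Context {R : realType} (X1 X2 : diffspace R) (Y : set X1).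
Context (f : subset_space Y -> X2).

Lemma glue_inl_smooth : dsmooth (fun x : X1 => glue_cls f (inl x)).
Proof.
move=> n U p pp; apply: (locally_plotW (@lifted_plot_comp _ _ _)).
exists (fun u => inl (p u)) => //.
apply: (locally_plotW (@summand_plot_comp _ _ _)).
by left; exists p.
Qed.

Lemma glue_inr_smooth : dsmooth (fun x : X2 => glue_cls f (inr x)).
Proof.
move=> n U p pp; apply: (locally_plotW (@lifted_plot_comp _ _ _)).
exists (fun u => inr (p u)) => //.
apply: (locally_plotW (@summand_plot_comp _ _ _)).
by right; exists p.
Qed.

(** Smoothness is local, so a map depending on a plot of the glued space may be
    tested where that plot comes from a single piece. The map [h] has the same
    domain as the plot and is otherwise arbitrary: in the fibre product it
    depends on two plots, and the principle is applied to each in turn. *)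
Lemma glue_plot_ind (Z : diffspace R) n (U : domain R n)
    (p : U -> glue_space f) (h : U -> Z) :
  plot p ->
  (forall (W : domain R n) (s : W `<=` U) (q : W -> X1), plot q ->
    (forall w, p (set_incl s w) = glue_cls f (inl (q w))) ->
    plot (h \o set_incl s)) ->
  (forall (W : domain R n) (s : W `<=` U) (q : W -> X2), plot q ->
    (forall w, p (set_incl s w) = glue_cls f (inr (q w))) ->
    plot (h \o set_incl s)) ->
  plot h.
Proof.
move=> pp hl hr; apply: plot_local => u.
have [W [s [Wu [q qp pq]]]] := pp u.
have [W' [s' [W'u sq]]] := qp (into Wu).
exists W', (subset_trans s' s); split=> //.
have pE w : p (set_incl (subset_trans s' s) w) =
            glue_cls f (q (set_incl s' w)).
  by rewrite -[RHS]pq /=; congr p; exact: val_inj.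
case: sq => -[r rp qr]; [apply: hl rp _|apply: hr rp _] => w;
  by rewrite pE -qr.
Qed.

Lemma glue_inl_inr (x : X1) (z : X2) :
  glue_cls f (inl x) = glue_cls f (inr z) ->
  exists Yx : Y x, f (into Yx) = z.
Proof.
move=> /glue_clsP; have [Yx|Yx] := pselect (Y x); last by rewrite glue_nf_out.
by rewrite (glue_nf_in f (into Yx)) => -[fz]; exists Yx.
Qed.

Lemma glue_inr_inj (x z : X2) :
  glue_cls f (inr x) = glue_cls f (inr z) -> x = z.
Proof. by move=> /glue_clsP []. Qed.

(** Injectivity is what excludes that two points of [Y] become equal through
    their images in [X2]. *)
Lemma glue_inl_inj (x z : X1) : injective f ->
  glue_cls f (inl x) = glue_cls f (inl z) -> x = z.
Proof.
move=> f_inj xz; have [Yx|Yx] := pselect (Y x).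
  have := xz; rewrite -cls_glue_nf (glue_nf_in f (into Yx)).
  by move=> /esym/glue_inl_inr [Yz /f_inj /(congr1 val)].
have [Yz|Yz] := pselect (Y z).
  have := xz; rewrite -[RHS]cls_glue_nf (glue_nf_in f (into Yz)).
  by move=> /glue_inl_inr [].
by move/glue_clsP: xz; rewrite !glue_nf_out // => -[].
Qed.

End GluedPlots.

(** * Fibrewise operations read in an arbitrary fibre *)

(** [fibre_add] and [fibre_scale] compute in the fibre over the projection of
    their own argument. The lemmas below allow any name [x] for the base point,
    which avoids casts between fibres over provably equal points. *)

Section FibreOps.
Context {R : realType} {V X : diffspace R} (pi : V -> X).
Context (vs : fibre_structure pi).

Lemma fibre_addE (x : X) (u v : fibre_mod vs x)
    (uv : subset_space (X := prod_space V V) (fibre_prod pi)) :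
  (val uv).1 = val u -> (val uv).2 = val v -> fibre_add vs uv = val (u + v).
Proof.
move=> e1 e2; have ex : pi (val uv).1 = x by rewrite e1; exact: (ofset u).
rewrite /fibre_add; case: _ / ex u v e1 e2 => u v e1 e2.
have <- : in_fibre vs (erefl (pi (val uv).1)) = u by exact: val_inj.
have <- // : in_fibre vs (esym (ofset uv : pi (val uv).1 = pi (val uv).2)) = v.
exact: val_inj.
Qed.

Lemma fibre_scaleE (x : X) (v : fibre_mod vs x)
    (av : prod_space (real_space R) V) :
  av.2 = val v -> fibre_scale vs av = val ((av.1 : R) *: v).
Proof.
move=> e; have ex : pi av.2 = x by rewrite e; exact: (ofset v).
rewrite /fibre_scale; case: _ / ex v e => v e.
have <- // : in_fibre vs (erefl (pi av.2)) = v; exact: val_inj.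
Qed.

End FibreOps.

(** * The glued bundle *)

Section GluedBundle.
Context {R : realType} {V1 X1 V2 X2 : diffspace R}.
Context (pi1 : V1 -> X1) (vs1 : fibre_structure pi1).
Context (pi2 : V2 -> X2) (vs2 : fibre_structure pi2).
Context (Y : set X1) (f : subset_space Y -> X2).
Context (ft : subset_space (pi1 @^-1` Y) -> V2).
Context (compat : forall v, pi2 (ft v) = f (over_base pi1 v)).
Context (ft_linear : forall y : subset_space Y,
  linear (ft_fibre vs1 vs2 compat y)).

Local Notation gpi := (glue_proj pi1 pi2 f ft).
Local Notation gvs := (glue_fibre_structure vs1 vs2 compat).

(** Over a point [y] of [Y] the map to the glued fibre is the linear map [ft]
    followed by the map from the fibre of [pi2] over [f y], which is a normal
    form. *)
Lemma glue_fibre_map_linear_any (a : sum_space X1 X2) (c : glue_space f)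
    (ac : glue_cls f a = c) :
  linear (glue_fibre_map compat ac :
    sum_fibre vs1 vs2 a -> fibre_mod gvs c).
Proof.
have [nfa|] := pselect (glue_nf f a = a); first exact: glue_fibre_map_linear.
case: a ac => [x|//] ac; have [Yx|Yx] := pselect (Y x); last first.
  by rewrite glue_nf_out.
move=> _; pose y : subset_space Y := into Yx.
have yc : glue_cls f (inr (f y)) = c by rewrite -ac -[RHS]cls_glue_nf
  -[x]/(val y) glue_nf_in.
have E (v : fibre_mod vs1 x) :
    glue_fibre_map (vs1 := vs1) (vs2 := vs2) compat ac v =
    glue_fibre_map (vs1 := vs1) compat yc (ft_fibre vs1 vs2 compat y v).
  apply: val_inj => /=; rewrite -[LHS]cls_glue_nf; congr glue_cls.
  exact: (glue_nf_in ft (into (over_fibre (y := y) v))).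
move=> k u v; rewrite !E ft_linear.
exact: (glue_fibre_map_linear compat yc erefl).
Qed.

(** The addition of the glued bundle can be computed on any representatives,
    provided that they lie in one fibre of the disjoint union. *)
Lemma glue_add (a : sum_space X1 X2) (u v : sum_fibre vs1 vs2 a)
    (uv : subset_space (X := prod_space (glue_space ft) (glue_space ft))
            (fibre_prod gpi)) :
  (val uv).1 = glue_cls ft (sum_fibre_pt u) ->
  (val uv).2 = glue_cls ft (sum_fibre_pt v) ->
  fibre_add gvs uv = glue_cls ft (sum_fibre_pt (u + v)).
Proof.
pose F (w : sum_fibre vs1 vs2 a) : fibre_mod gvs (glue_cls f a) :=
  glue_fibre_map compat erefl w.
move=> e1 e2; rewrite (@fibre_addE _ _ _ _ gvs _ (F u) (F v)) //.
have /(_ 1 u v) := glue_fibre_map_linear_any (erefl (glue_cls f a)).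
by rewrite !scale1r => <-.
Qed.

Lemma glue_zero (a : sum_space X1 X2) :
  zero_section gvs (glue_cls f a) =
  glue_cls ft (sum_fibre_pt (0 : sum_fibre vs1 vs2 a)).
Proof.
(* A linear map sends 0 = -1 *: 0 + 0 to -1 *: 0' + 0' = 0'. *)
have /(_ (-1) 0 0) := glue_fibre_map_linear_any (erefl (glue_cls f a)).
by rewrite !scaleN1r !addNr => /(congr1 val).
Qed.

Lemma glue_scale (a : sum_space X1 X2) (v : sum_fibre vs1 vs2 a)
    (kv : prod_space (real_space R) (glue_space ft)) :
  kv.2 = glue_cls ft (sum_fibre_pt v) ->
  fibre_scale gvs kv = glue_cls ft (sum_fibre_pt ((kv.1 : R) *: v)).
Proof.
pose F (w : sum_fibre vs1 vs2 a) : fibre_mod gvs (glue_cls f a) :=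
  glue_fibre_map compat erefl w.
move=> e; rewrite (@fibre_scaleE _ _ _ _ gvs _ (F v)) //.
have L := glue_fibre_map_linear_any (erefl (glue_cls f a)).
have F0 : F 0 = 0 :> fibre_mod gvs _.
  by have := L (-1) 0 0; rewrite !scaleN1r !addNr.
have FZ : F ((kv.1 : R) *: v + 0) = (kv.1 : R) *: F v + F 0 := L _ v 0.
by rewrite F0 !addr0 in FZ; rewrite -FZ.
Qed.

Lemma plot_glue_add_inl (n : nat) (U : domain R n) (a b : U -> V1)
    (r : U -> subset_space (X := prod_space (glue_space ft) (glue_space ft))
            (fibre_prod gpi)) :
  injective f -> dsmooth (fibre_add vs1) -> plot a -> plot b ->
  (forall u, (val (r u)).1 = glue_cls ft (inl (a u))) ->
  (forall u, (val (r u)).2 = glue_cls ft (inl (b u))) ->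
  plot (fibre_add gvs \o r).
Proof.
move=> f_inj add1 ap bp aE bE.
(* The two plots project to the same points of the glued base, and X1 embeds
   in it. *)
have ab u : pi1 (a u) = pi1 (b u).
  have := ofset (r u); rewrite /fibre_prod /= aE bE !glue_projE //.
  exact: glue_inl_inj.
pose ab_pair u : subset_space (X := prod_space V1 V1) (fibre_prod pi1) :=
  into (ab u : fibre_prod pi1 (a u, b u)).
have sp : plot (fibre_add vs1 \o ab_pair) by apply: add1; split.
rewrite (_ : _ \o _ = fun u => glue_cls ft (inl ((fibre_add vs1 \o ab_pair) u))).
  exact/glue_inl_smooth.
apply/funext => u.
pose va : fibre_mod vs1 (pi1 (a u)) := in_fibre vs1 erefl.
pose vb : fibre_mod vs1 (pi1 (a u)) := in_fibre vs1 (esym (ab u)).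
rewrite /comp (fibre_addE (u := va) (v := vb)) //.
exact: (glue_add (a := inl (pi1 (a u))) (u := va) (v := vb)).
Qed.

Lemma plot_glue_add_inr (n : nat) (U : domain R n) (a b : U -> V2)
    (r : U -> subset_space (X := prod_space (glue_space ft) (glue_space ft))
            (fibre_prod gpi)) :
  dsmooth (fibre_add vs2) -> plot a -> plot b ->
  (forall u, (val (r u)).1 = glue_cls ft (inr (a u))) ->
  (forall u, (val (r u)).2 = glue_cls ft (inr (b u))) ->
  plot (fibre_add gvs \o r).
Proof.
move=> add2 ap bp aE bE.
have ab u : pi2 (a u) = pi2 (b u).
  have := ofset (r u); rewrite /fibre_prod /= aE bE !glue_projE //.
  exact: glue_inr_inj.
pose ab_pair u : subset_space (X := prod_space V2 V2) (fibre_prod pi2) :=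
  into (ab u : fibre_prod pi2 (a u, b u)).
have sp : plot (fibre_add vs2 \o ab_pair) by apply: add2; split.
rewrite (_ : _ \o _ = fun u => glue_cls ft (inr ((fibre_add vs2 \o ab_pair) u))).
  exact/glue_inr_smooth.
apply/funext => u.
pose va : fibre_mod vs2 (pi2 (a u)) := in_fibre vs2 erefl.
pose vb : fibre_mod vs2 (pi2 (a u)) := in_fibre vs2 (esym (ab u)).
rewrite /comp (fibre_addE (u := va) (v := vb)) //.
exact: (glue_add (a := inr (pi2 (a u))) (u := va) (v := vb)).
Qed.

(** This reduces the mixed case of addition to the case of two lifts to [V2]:
    a point of [X1] whose class comes from [X2] belongs to [Y], so [ft] may be
    applied, and it does not change classes. *)
Lemma glue_lift_over_Y (n : nat) (U : domain R n) (a : U -> V1) (b : U -> V2) :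
  dsmooth ft -> plot a ->
  (forall u, gpi (glue_cls ft (inl (a u))) = gpi (glue_cls ft (inr (b u)))) ->
  exists2 c : U -> V2, plot c &
    forall u, glue_cls ft (inl (a u)) = glue_cls ft (inr (c u)).
Proof.
move=> fts ap ab.
have aY u : (pi1 @^-1` Y) (a u).
  by have := ab u; rewrite !glue_projE // => /glue_inl_inr [].
exists (fun u => ft (into (aY u))).
  by apply: (fts _ _ (fun u => into (aY u))).
by move=> u; rewrite -[LHS]cls_glue_nf (glue_nf_in ft (into (aY u))).
Qed.

End GluedBundle.

Theorem theorem3p3 (R : realType) (V1 X1 V2 X2 : diffspace R)
    (pi1 : V1 -> X1) (vs1 : fibre_structure pi1)
    (bundle1 : is_pseudobundle pi1 vs1)
    (pi2 : V2 -> X2) (vs2 : fibre_structure pi2)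
    (bundle2 : is_pseudobundle pi2 vs2)
    (Y : set X1) (f : subset_space Y -> X2)
    (f_smooth : dsmooth f) (f_inj : injective f)
    (ft : subset_space (pi1 @^-1` Y) -> V2) (ft_smooth : dsmooth ft)
    (compat : forall v, pi2 (ft v) = f (over_base pi1 v))
    (ft_linear : forall y : subset_space Y,
      linear (ft_fibre vs1 vs2 compat y)) :
  is_pseudobundle (glue_proj pi1 pi2 f ft)
    (glue_fibre_structure vs1 vs2 compat).
Proof.
have [pi1s add1 scale1 zero1] := bundle1.
have [pi2s add2 scale2 zero2] := bundle2.
split.
- move=> n U p pp; apply: (glue_plot_ind pp) => W s q qp pq.
    rewrite (_ : _ \o _ = fun w => glue_cls f (inl (pi1 (q w)))).
      exact/glue_inl_smooth/pi1s.
    by apply/funext => w; rewrite /= pq glue_projE.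
  rewrite (_ : _ \o _ = fun w => glue_cls f (inr (pi2 (q w)))).
    exact/glue_inr_smooth/pi2s.
  by apply/funext => w; rewrite /= pq glue_projE.
- move=> n U r [r1 r2].
  have rE u : glue_proj pi1 pi2 f ft (val (r u)).1 =
              glue_proj pi1 pi2 f ft (val (r u)).2 by exact: ofset (r u).
  (* First localize so that the first summand lifts, then the second. *)
  apply: (glue_plot_ind r1) => W s a ap aE;
    apply: (glue_plot_ind (plot_comp (domain_smooth_incl s) r2)) =>
      W' s' b bp bE; have a'p := plot_comp (domain_smooth_incl s') ap;
    have a'E w := aE (set_incl s' w);
    pose r' := (r \o set_incl s) \o set_incl s';
    rewrite -[_ \o _]/(fibre_add (glue_fibre_structure vs1 vs2 compat) \o r');
    have r'E w := rE (set_incl s (set_incl s' w)).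
  (* Four cases: the summands lift to (V1, V1), (V1, V2), (V2, V1), (V2, V2). *)
  + exact: (plot_glue_add_inl ft_linear f_inj add1 a'p bp a'E bE).
  + have ab w := etrans (etrans (congr1 _ (esym (a'E w))) (r'E w))
      (congr1 _ (bE w)).
    have [c cp cE] := glue_lift_over_Y compat ft_smooth a'p ab.
    apply: (plot_glue_add_inr ft_linear add2 cp bp _ bE) => w.
    by rewrite -cE; exact: a'E.
  + have ba w := etrans (etrans (congr1 _ (esym (bE w))) (esym (r'E w)))
      (congr1 _ (a'E w)).
    have [c cp cE] := glue_lift_over_Y compat ft_smooth bp ba.
    apply: (plot_glue_add_inr ft_linear add2 a'p cp a'E) => w.
    by rewrite -cE; exact: bE.
  + exact: (plot_glue_add_inr ft_linear add2 a'p bp a'E bE).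
- move=> n U r [r1 r2].
  apply: (glue_plot_ind r2) => W s v vp vE.
    rewrite (_ : _ \o _ = fun w => glue_cls ft (inl (fibre_scale vs1
      ((r (set_incl s w)).1, v w)))).
      apply/glue_inl_smooth/scale1; split=> //.
      exact: (plot_comp (domain_smooth_incl s) r1).
    apply/funext => w.
    exact: (glue_scale ft_linear (a := inl (pi1 (v w)))
      (v := in_fibre vs1 erefl) (vE w)).
  rewrite (_ : _ \o _ = fun w => glue_cls ft (inr (fibre_scale vs2
      ((r (set_incl s w)).1, v w)))).
    apply/glue_inr_smooth/scale2; split=> //.
    exact: (plot_comp (domain_smooth_incl s) r1).
  apply/funext => w.
  exact: (glue_scale ft_linear (a := inr (pi2 (v w)))
    (v := in_fibre vs2 erefl) (vE w)).
- move=> n U p pp; apply: (glue_plot_ind pp) => W s q qp pq.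
    rewrite (_ : _ \o _ = fun w => glue_cls ft (inl (zero_section vs1 (q w)))).
      exact/glue_inl_smooth/zero1.
    by apply/funext => w; rewrite /= pq (glue_zero ft_linear).
  rewrite (_ : _ \o _ = fun w => glue_cls ft (inr (zero_section vs2 (q w)))).
    exact/glue_inr_smooth/zero2.
  by apply/funext => w; rewrite /= pq (glue_zero ft_linear).
Qed.
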